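(* Let $L$ be the subdivision of the $j$-simplex with one interior vertex, namely the one obtained by starring (the cone from one new interior vertex over the boundary complex of the $j$-simplex). Assume $1\leq j\leq i$, and let $d\ge 1$. Then $g^{(i)}(\diamondsuit(d,L))\geq 0$ (component-wise).
   Context: Simplicial complexes are finite and abstract, and contain the empty face. $f_i(K)$ is the number of $i$-dimensional faces of $K$; the link of $\sigma\in K$ is $\mathrm{link}_K(\sigma)=\{\tau\in K:\sigma\cap\tau=\emptyset,\ \sigma\cup\tau\in K\}$. For a complex of dimension $d-1$, the $h$-polynomial is $h(K,t)=\sum_{i=0}^{d}h_i t^i$ with $h_i=\sum_{l=0}^{i}(-1)^{i-l}\binom{d-l}{i-l}f_{l-1}(K)$. For $d\ge 0$, $i\geq 1$, and a $(d-1)$-dimensional homology sphere $\Delta$ (so $h_l=h_{d-l}$), the vector $g^{(i)}(\Delta)$ is the vector of coefficients when $h(\Delta,t)$ is expressed in the basis $\left(P_{d,i}(t),\,tP_{d-2,i}(t),\,t^2P_{d-4,i}(t),\ldots,t^{\lfloor d/2\rfloor}P_{d-2\lfloor d/2\rfloor,i}(t)\right)$, where for $d\geq 1$, $P_{d,i}(t)=(1+t+\cdots+t^i)^q(1+t+\cdots+t^r)$ with $q\geq 0$, $1\leq r\leq i$ the unique integers such that $d=qi+r$, and $P_{0,i}(t)=1$. Generalized Tchebyshev triangulation: let $L$ be a triangulation of a $j$-simplex with no new vertices on the boundary, with boundary complex $\partial(L)$ (that of the simplex). A complex $K'$ is a generalized Tchebyshev triangulation of $K$ induced by $L$ if there is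 an ordered list $\sigma_1,\ldots,\sigma_m$ of all the $j$-dimensional faces of $K$, bijections $\phi_{\sigma_l}$ from the vertices of $\partial(L)$ to $\sigma_l$, and complexes $K_0=K,\ldots,K_m=K'$ such that $K_l$ is obtained from $K_{l-1}$ by replacing the faces $\{\sigma_l\cup\tau:\tau\in\mathrm{link}_{K_{l-1}}(\sigma_l)\}$ by $\{\sigma'\cup\tau:\sigma'\in L_l,\ \tau\in\mathrm{link}_{K_{l-1}}(\sigma_l)\}$, where $L_l$ is a copy of $L$ whose boundary vertices are identified with $\sigma_l$ via $\phi_{\sigma_l}$ and whose interior vertices are new. $\diamondsuit(d)$ is the boundary complex of the $d$-dimensional cross-polytope, and $\diamondsuit(d,L)$ denotes any generalized Tchebyshev triangulation of $\diamondsuit(d)$ induced by $L$ (all of them are simplicial spheres with the same $f$-vector, hence the same $g^{(i)}$). *)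

(* Defs.v *)
From HB Require Import structures.
From mathcomp Require Import all_boot all_order all_algebra.
From mathcomp Require Import finmap.

Set Implicit Arguments.
Unset Strict Implicit.
Unset Printing Implicit Defensive.

Import GRing.Theory.
Local Open Scope fset_scope.
Local Open Scope ring_scope.

(* A finite abstract simplicial complex is represented by the finite set of
   its faces, the empty face included. *)
Notation complex V := {fset {fset V}}.

Section Complexes.
Variable V : choiceType.
Implicit Types (K : complex V) (s : {fset V}).

Definition verts K : {fset V} := \bigcup_(s <- K) s.

(* dim K + 1 *)
Definition rank K : nat := \max_(s <- K) #|` s|.

(* The faces of cardinality l, i.e. of dimension l - 1. *)
Definition faces K (l : nat) : complex V := [fset s in K | #|` s| == l].

(* f_{l-1}(K) *)
Definition fnum K (l : nat) : nat := #|` faces K l|.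

Definition link K s : complex V :=
  [fset t in K | (s `&` t == fset0) && (s `|` t \in K)].

Definition hcoef K (i : nat) : int :=
  \sum_(l < i.+1) (-1) ^+ (i - l) * 'C(rank K - l, i - l)%:R * (fnum K l)%:R.

Definition hpoly K : {poly int} := \poly_(i < (rank K).+1) hcoef K i.

Definition simplex_boundary (B : {fset V}) : complex V := fpowerset B `\ B.

Definition cone (v : V) K : complex V := K `|` [fset v |` s | s in K].

(* The simplex with vertex set B, starred at the new interior vertex v. *)
Definition starring (B : {fset V}) (v : V) : complex V :=
  cone v (simplex_boundary B).

(* The boundary complex of the d-dimensional cross-polytope; its vertices are
   labelled by e, with e (k, true) and e (k, false) antipodal. *)
Definition cross_polytope (d : nat) (e : 'I_d * bool -> V) : complex V :=
  [fset s in fpowerset [fset e x | x : 'I_d * bool] |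
    [forall k, ~~ ((e (k, true) \in s) && (e (k, false) \in s))]].

End Complexes.

Section Tchebyshev.
Variables (W V : choiceType).

(* Replace {s U t | t in link s} by {s' U t | s' in psi(L), t in link s}. *)
Definition replace_face (L : complex W) (psi : W -> V) (s : {fset V})
    (K : complex V) : complex V :=
  (K `\` [fset s `|` t | t in link K s])
  `|` [fset (psi @` s') `|` t | s' : {fset W} in L, t : {fset V} in link K s].

(* psi embeds L as a copy of L whose boundary vertices B are identified with s
   (the bijection phi_s is the restriction of psi to B) and whose interior
   vertices are not vertices of K. *)
Definition gluing_map (L : complex W) (B : {fset W}) (K : complex V)
    (s : {fset V}) (psi : W -> V) : Prop :=
  [/\ {in verts L &, injective psi},
      psi @` B = s
    & forall w, w \in verts L -> w \notin B -> psi w \notin verts K].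

(* K' is a generalized Tchebyshev triangulation of K induced by L, where L is
   a triangulation of the simplex with vertex set B without new vertices on
   the boundary. With j the dimension of that simplex, the j-dimensional faces
   of K are those of cardinality #|` B|. *)
Definition gen_tchebyshev (L : complex W) (B : {fset W}) (K K' : complex V)
    : Prop :=
  exists (sigma : seq {fset V}) (psi : nat -> W -> V) (Ks : nat -> complex V),
    [/\ uniq sigma,
        sigma =i faces K #|` B|,
        Ks 0%N = K,
        Ks (size sigma) = K'
      & forall l, (l < size sigma)%N ->
          let s := nth fset0 sigma l in
          gluing_map L B (Ks l) s (psi l) /\
          Ks l.+1 = replace_face L (psi l) s (Ks l)].

End Tchebyshev.

(* 1 + t + ... + t^n *)
Definition geom (n : nat) : {poly int} := \sum_(k < n.+1) 'X^k.

Definition quo_part (d i : nat) : nat := (d.-1 %/ i)%N.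
Definition rem_part (d i : nat) : nat := (d.-1 %% i).+1.

Lemma quo_rem_partP (d i q r : nat) : (0 < d)%N -> (0 < i)%N ->
  (d = q * i + r /\ 0 < r <= i)%N <-> (q = quo_part d i /\ r = rem_part d i).
Proof.
case: d => // d _ i0; rewrite /quo_part /rem_part /=; split.
  case: r => [[_]|r [E /andP[_ ri]]] //; move: E.
  rewrite addnS => -[->].
  by rewrite divnMDl // modnMDl divn_small // modn_small // addn0.
by move=> [-> ->]; rewrite addnS -divn_eq ltn_pmod.
Qed.

(* By quo_rem_partP, d = q i + r with 1 <= r <= i for q := quo_part d i and
   r := rem_part d i, provided d, i >= 1. *)
Definition Ppoly (d i : nat) : {poly int} :=
  if d is 0%N then 1 else geom i ^+ quo_part d i * geom (rem_part d i).

(* c is the vector g^(i)(K): the coefficients of h(K,t) in the basis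
   t^k P_{d-2k,i}(t), 0 <= k <= d/2, where d = dim K + 1. They exist when
   h(K,t) is symmetric. *)
Definition is_gvector (V : choiceType) (i : nat) (K : complex V)
    (c : 'rV[int]_((rank K)./2).+1) : Prop :=
  hpoly K = \sum_(k < ((rank K)./2).+1)
              c 0 k *: ('X^k * Ppoly (rank K - k.*2) i).

Arguments is_gvector {V} i K c.

Lemma geom_coef0 n : (geom n)`_0 = 1.
Proof.
rewrite /geom big_ord_recl expr0 coefD coef1 coef_sum big1 ?addr0 // => k _.
by rewrite coefXn.
Qed.

Lemma Ppoly_coef0 d i : (Ppoly d i)`_0 = 1.
Proof.
case: d => [|d]; first by rewrite coef1.
rewrite /Ppoly coef0M geom_coef0 mulr1; elim: quo_part => [|q IH].
  by rewrite expr0 coef1.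
by rewrite exprS coef0M geom_coef0 mul1r.
Qed.

Lemma is_gvector_uniq (V : choiceType) (i : nat) (K : complex V)
    (c c' : 'rV[int]_((rank K)./2).+1) :
  is_gvector i K c -> is_gvector i K c' -> c = c'.
Proof.
rewrite /is_gvector => -> E; apply/rowP => k.
have [n] := ubnP (k : nat); elim: n k => // n IH k; rewrite ltnS => kn.
have /(congr1 (fun p : {poly int} => p`_k)) := E; rewrite !coef_sum.
rewrite (bigD1 k) // [RHS](bigD1 k) //= !coefZ !coefXnM ltnn subnn.
rewrite Ppoly_coef0 !mulr1 => H.
apply: (addIr _ (etrans H _)); congr (_ + _).
apply: eq_bigr => l lk; rewrite !coefZ !coefXnM.
case: ltnP => [_|le]; first by rewrite !mulr0.
rewrite (IH l) //; apply: leq_trans kn.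
by rewrite ltn_neqAle le andbT; apply: contra lk => /eqP/val_inj->.
Qed.

(* Main.v *)
Require Import Defs.
From HB Require Import structures.
From mathcomp Require Import all_boot all_order all_algebra.
From mathcomp Require Import finmap.
From mathcomp Require Import ring zify.

(** A subdivision step replaces the star of a face s with j + 1 vertices by the
cone over its boundary, i.e. it is a stellar subdivision at s. Its effect on
h-polynomials is explicit, also for all links of the new complex K'. Write a
for the number of vertices of s outside r, where r does not contain s. If r is
an old face, then
  h(link_K' r) = h(link_K r) + (t + ... + t^(a-1)) h(link_K (s U r)),
where the last term is 0 unless s U r is a face, while the link of a new face
w U r, with w the new vertex, is the join of the boundary of an (a-1)-simplex
with link_K (s U r), so that
  h(link_K' (w U r)) = (1 + ... + t^(a-1)) h(link_K (s U r)).

Hence it is fruitful to ask for positivity of all links at once. Call K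
positive ([gpositive]) if the h-polynomial of each link is a nonnegative
combination of the polynomials t^k P_{n-2k,i}(t), where n is the rank of the
link; these combinations form the cone [gcone i n]. Since a <= j + 1 <= i + 1,
the two formulas only multiply by 1 + ... + t^b with b <= i, and by t, and the
cones are stable under both ([gcone_mul_geom], [gcone_mulX]). So stellar
subdivision at a face with at most i + 1 vertices preserves positivity
([gpositive_stellar]), whatever the order of the subdivisions and whatever
happened before. The links of the cross-polytope have h-polynomials (1 + t)^n,
a product of factors 1 + t, so the cross-polytope is positive
([gpositive_cross_polytope]). The theorem is positivity of the final complex at
the empty face.

As P_{n,i} is a power of G_i times some G_r, with G_n = 1 + ... + t^n, stability
under multiplication by G_b concerns products of G_i^q with two factors G_m G_n,
where n <= m <= i. The identity
  G_m G_n = G_(m+1) G_(n-1) + t^n G_(m-n)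
moves degree from the smaller to the larger factor, until the latter is G_i or
the former is 1, at the cost of a term of the required form
([geom_exchange], [gcone_geom2]). *)

Set Implicit Arguments.
Unset Strict Implicit.
Unset Printing Implicit Defensive.

Import GRing.Theory.
Local Open Scope fset_scope.
Local Open Scope ring_scope.

(** * The polynomials 1 + t + ... + t^n *)

Lemma geomS n : geom n.+1 = geom n + 'X^(n.+1).
Proof. by rewrite /geom big_ord_recr. Qed.

Lemma geom0 : geom 0 = 1.
Proof. by rewrite /geom big_ord1 expr0. Qed.

Lemma geom_add m n : geom (m + n).+1 = geom m + 'X^(m.+1) * geom n.
Proof.
elim: n => [|n IH]; first by rewrite addn0 geomS geom0 mulr1.
by rewrite addnS geomS IH geomS mulrDr -addrA -exprD !addSn addnS.
Qed.

Lemma geom_telescope n : (1 - 'X) * geom n = 1 - 'X^(n.+1).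
Proof.
elim: n => [|n IH]; first by rewrite geom0 mulr1 expr1.
by rewrite geomS mulrDr IH [in RHS]exprS; ring.
Qed.

Lemma onemX_neq0 : (1 - 'X : {poly int}) != 0.
Proof. by rewrite -opprB oppr_eq0 polyXsubC_eq0. Qed.

(** Splitting off the last summands of G_(n+1) and G_(m+1) leaves the difference
t^(n+1) G_m - t^(m+1) G_n, in which G_m = G_(m-n-1) + t^(m-n) G_n. *)
Lemma geom_exchange m n : (n < m)%N ->
  geom m * geom n.+1 = geom m.+1 * geom n + 'X^(n.+1) * geom (m - n.+1).
Proof.
move=> nm; have E : geom m = geom (m - n.+1) + 'X^(m - n) * geom n.
  by rewrite -[in LHS](subnK nm) addnS geom_add subnS prednK // subn_gt0.
rewrite !geomS mulrDr mulrDl {2}E.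
have -> : 'X^(m.+1) = 'X^(n.+1) * 'X^(m - n) :> {poly int}.
  by rewrite -exprD addSn subnKC // ltnW.
ring.
Qed.

(** * The cones of polynomials with nonnegative g-vector *)

(** The generators of [gcone i n] are the t^k P_{n-2k,i}; naming n - 2k instead of
n avoids subtraction, and makes closure properties inductions. *)
Inductive gcone (i : nat) : nat -> {poly int} -> Prop :=
| gcone0 d : gcone i d 0
| gconeD d p q : gcone i d p -> gcone i d q -> gcone i d (p + q)
| gcone_basis d k : gcone i (d + k.*2) ('X^k * Ppoly d i).

Lemma gcone_coords i d p : gcone i d p ->
  exists2 c : 'rV[int]_(d./2).+1, forall k, 0 <= c 0 k
    & p = \sum_(k < (d./2).+1) c 0 k *: ('X^k * Ppoly (d - k.*2) i).
Proof.
elim=> {d p} [d|d p q _ [c c0 ->] _ [c' c0' ->]|d k].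
- exists 0 => [k|]; first by rewrite mxE.
  by rewrite big1 // => k _; rewrite mxE scale0r.
- exists (c + c') => [k|]; first by rewrite mxE Num.Theory.addr_ge0.
  by rewrite -big_split; apply: eq_bigr => k _; rewrite mxE scalerDl.
- have kd : (k < ((d + k.*2)./2).+1)%N by lia.
  exists (delta_mx 0 (Ordinal kd)) => [l|].
    by rewrite mxE; case: (_ && _).
  rewrite (bigD1 (Ordinal kd)) //= big1 => [|l /negPf lk].
    by rewrite mxE !eqxx scale1r addr0 addnK.
  by rewrite mxE lk andbF scale0r.
Qed.

Lemma gcone_mulX i d p : gcone i d p -> gcone i d.+2 ('X * p).
Proof.
elim=> {d p} [d|d p q _ Hp _ Hq|d k].
- by rewrite mulr0; apply: gcone0.
- by rewrite mulrDr; apply: gconeD.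
- rewrite mulrA -exprS -addnS -[X in gcone _ X]addnS -doubleS.
  exact: gcone_basis.
Qed.

Lemma gcone_mulXn i d k p : gcone i d p -> gcone i (d + k.*2) ('X^k * p).
Proof.
move=> Hp; elim: k => [|k IH]; first by rewrite mul1r addn0.
by rewrite doubleS !addnS exprS -mulrA; apply: gcone_mulX.
Qed.

Section Geom.
Variables (i : nat) (i0 : (0 < i)%N).

(** Allowing r = 0 here, where i q = i (q - 1) + i is the normalized division,
spares a case distinction in each use. *)
Lemma Ppoly_geom q r : (r <= i)%N -> Ppoly (q * i + r) i = geom i ^+ q * geom r.
Proof.
move=> ri; have [r0|] := posnP r; last first.
  move=> r0; have d0 : (0 < q * i + r)%N by rewrite addn_gt0 r0 orbT.
  have [|Eq Er] := (quo_rem_partP q r d0 i0).1; first by rewrite r0 ri; split.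
  move: d0 Eq Er; case: (q * i + r)%N => // d _ Eq Er.
  by rewrite /Ppoly -Eq -Er.
rewrite r0 geom0 mulr1 addn0; case: q => [|q]; first by rewrite mul0n expr0.
have d0 : (0 < q.+1 * i)%N by rewrite muln_gt0.
have [|Eq Er] := (quo_rem_partP q i d0 i0).1.
  by rewrite mulSn addnC i0 leqnn; split.
move: d0 Eq Er; case: (q.+1 * i)%N => // d _ Eq Er.
by rewrite /Ppoly -Eq -Er exprSr.
Qed.

(** Induction on the smaller index a: either r = i, and the product already is
some P, or [geom_exchange] applies and its last term is a shifted P. *)
Lemma gcone_geom2 q r a : (r <= i)%N -> (a <= r)%N ->
  gcone i (q * i + r + a) (geom i ^+ q * (geom r * geom a)).
Proof.
have gP q' r' : (r' <= i)%N -> gcone i (q' * i + r') (geom i ^+ q' * geom r').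
  move=> ri; have := gcone_basis i (q' * i + r') 0.
  by rewrite mul1r addn0 Ppoly_geom.
elim: a r => [|a IH] r ri ar; first by rewrite geom0 mulr1 addn0; apply: gP.
have [ir|ri'] := leqP i r.
  have {ri ir} ri : r = i by apply/eqP; rewrite eqn_leq ri.
  by rewrite ri in ar *; rewrite mulrA -exprSr -mulSnr; apply: gP.
rewrite geom_exchange // mulrDr; apply: gconeD.
  have -> : (q * i + r + a.+1 = q * i + r.+1 + a)%N by lia.
  by apply: IH; lia.
rewrite mulrCA.
have -> : (q * i + r + a.+1 = q * i + (r - a.+1) + a.+1.*2)%N by lia.
by apply: gcone_mulXn; apply: gP; lia.
Qed.

Lemma gcone_mul_geom d p a :
  (a <= i)%N -> gcone i d p -> gcone i (d + a) (p * geom a).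
Proof.
move=> ai; elim=> {d p} [d|d p q _ Hp _ Hq|d k].
- by rewrite mul0r; apply: gcone0.
- by rewrite mulrDl; apply: gconeD.
- rewrite -mulrA addnAC; apply: gcone_mulXn.
  have -> : d = (d %/ i * i + d %% i)%N by rewrite -divn_eq.
  have ri : (d %% i <= i)%N by rewrite ltnW // ltn_pmod.
  rewrite Ppoly_geom // -mulrA.
  have [ar|ra] := leqP a (d %% i); first exact: gcone_geom2.
  rewrite addnAC [geom (d %% i) * _]mulrC.
  by apply: gcone_geom2 => //; apply: ltnW.
Qed.

End Geom.

Lemma gcone_1X i d : (0 < i)%N -> gcone i d ((1 + 'X) ^+ d).
Proof.
move=> i0; elim: d => [|d IH].
  by have := gcone_basis i 0 0; rewrite expr0 mul1r.
rewrite exprSr -addn1.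
have E : 1 + 'X = geom 1 by rewrite geomS geom0.
by rewrite E in IH *; apply: gcone_mul_geom.
Qed.

(** * Sums over subsets *)

(** The binomial theorem for t + (1 - t) = 1, expanded over subsets. *)
Lemma sum_fpowerset (V : choiceType) (A : {fset V}) :
  \sum_(k <- fpowerset A) 'X^(#|` A| - #|` k|) * (1 - 'X) ^+ #|` k|
    = 1 :> {poly int}.
Proof.
have [n] := ubnP #|` A|; elim: n A => // n IH A; rewrite ltnS => cA.
have [->|[a aA]] := fset_0Vmem A.
  by rewrite fpowerset0 big_seq_fset1 cardfs0 !expr0 mulr1.
pose B := A `\ a.
have aB : a \notin B by rewrite !inE eqxx.
have AB : A = a |` B by rewrite fsetD1K.
have cAB : #|` A| = #|` B|.+1 by rewrite AB cardfsU1 aB.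
have subB k : k \in fpowerset B -> a \notin k /\ (#|` k| <= #|` B|)%N.
  rewrite fpowersetE => kB; split; last exact: fsubset_leq_card.
  by apply: contra aB; apply: (fsubsetP kB).
have P : perm_eq (fpowerset A)
    (fpowerset B ++ [seq a |` k | k <- enum_fset (fpowerset B)]).
  apply: uniq_perm; first exact: fset_uniq.
    rewrite cat_uniq fset_uniq /= map_inj_in_uniq ?fset_uniq ?andbT.
      apply/hasPn => _ /mapP[k _ ->]; apply/negP => /subB[].
      by rewrite fset1U1.
    move=> k l /subB[ak _] /subB[al _] /(congr1 (fun x => x `\ a)).
    by rewrite !fsetU1K.
  move=> k; rewrite mem_cat !fpowersetE; apply/idP/orP => [kA|[kB|/mapP[l]]].
  - case: (boolP (a \in k)) => ak; [right|left].
      apply/mapP; exists (k `\ a); last by rewrite fsetD1K.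
      by rewrite fpowersetE fsubDset -AB.
    by rewrite fsubsetD1 kA.
  - by apply: fsubset_trans kB _; rewrite AB fsubsetUr.
  - by rewrite fpowersetE => lB ->; rewrite AB fsetUS.
rewrite (perm_big _ P) big_cat big_map /= -big_split /= big_seq.
transitivity (\sum_(k <- fpowerset B | k \in fpowerset B)
   'X^(#|` B| - #|` k|) * (1 - 'X) ^+ #|` k| : {poly int}); last first.
  by rewrite -big_seq IH // -cAB.
apply: eq_bigr => k /subB[ak kB].
by rewrite cardfsU1 ak cAB subSn // add1n subSS !exprS; ring.
Qed.

(** This is (1 - t^n) / (1 - t): remove the empty set from [sum_fpowerset] and
divide by 1 - t, where n = #|A|. The complements of the k are the faces of the
boundary of the simplex on A, and the sum is its h-polynomial. *)
Lemma sum_nonempty_subsets (V : choiceType) (A : {fset V}) : A != fset0 ->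
  \sum_(k <- fpowerset A | k != fset0)
    'X^(#|` A| - #|` k|) * (1 - 'X) ^+ (#|` k| - 1) = geom (#|` A| - 1).
Proof.
rewrite -cardfs_gt0 => A0; apply: (mulfI onemX_neq0).
rewrite geom_telescope subn1 prednK // big_distrr /=.
rewrite -[X in _ = X - _](sum_fpowerset A).
rewrite [in RHS](bigD1_seq fset0) ?fset_uniq //; last first.
  by rewrite fpowersetE fsub0set.
rewrite cardfs0 subn0 mulr1 addrAC subrr add0r.
apply: eq_bigr => k; rewrite -cardfs_gt0 => k0.
by rewrite mulrCA -exprS subn1 prednK.
Qed.

(** * h-polynomials of links *)

Section LinkH.
Variable V : choiceType.
Implicit Types (K : complex V) (r s u : {fset V}).

(** The h-polynomial of the link of r in K, computed in rank d - #|r|: the faces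
of the link are the u minus r, and h is the sum of t^l (1 - t)^(n-l) over the
faces with l vertices of a complex of rank n. *)
Definition link_h d K r : {poly int} :=
  \sum_(u <- K | r `<=` u) 'X^(#|` u| - #|` r|) * (1 - 'X) ^+ (d - #|` u|).

Definition down_closed K := forall r u, r `<=` u -> u \in K -> r \in K.

Lemma sum_by_card K d (F : nat -> {poly int}) :
  (forall u, u \in K -> (#|` u| <= d)%N) ->
  \sum_(u <- K) F #|` u| = \sum_(l < d.+1) (fnum K l)%:R * F l.
Proof.
move=> Kd; rewrite big_seq.
rewrite (partition_big (fun u => inord #|` u| : 'I_d.+1) xpredT) //=.
apply: eq_bigr => l _; rewrite mulr_natl.
transitivity (\sum_(u <- faces K l) F l).
  rewrite [RHS](perm_big [seq u <- K | (u \in K) && (inord #|` u| == l)]).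
    rewrite big_filter; apply: eq_bigr => u /andP[/Kd uK /eqP <-].
    by rewrite inordK.
  apply: uniq_perm; rewrite ?filter_uniq ?fset_uniq // => u.
  rewrite mem_filter !inE; case uK: (u \in K); rewrite ?andbF // ?andbT.
  by rewrite -val_eqE /= inordK // ltnS Kd.
by rewrite big_const_seq count_predT iter_addr_0.
Qed.

Lemma coef_onemX_exp n k :
  ((1 - 'X) ^+ n : {poly int})`_k = (-1) ^+ k * 'C(n, k)%:R.
Proof.
have -> : (1 - 'X) ^+ n =
    \poly_(m < n.+1) ((-1) ^+ m * 'C(n, m)%:R) :> {poly int}.
  rewrite exprBn poly_def; apply: eq_bigr => m _.
  rewrite expr1n mulr1 -mulr_natr -mul_polyC rmorphM rmorphXn rmorphN1.
  by rewrite /= rmorph_nat mulrAC.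
by rewrite coef_poly ltnS; case: leqP => // nk; rewrite bin_small ?mulr0.
Qed.

Lemma hpoly_link_h K : hpoly K = link_h (rank K) K fset0.
Proof.
have Kd u : u \in K -> (#|` u| <= rank K)%N by move=> uK; apply: leq_bigmax_seq.
rewrite /link_h (eq_bigl xpredT) => [|u]; last exact: fsub0set.
under eq_bigr do rewrite cardfs0 subn0.
rewrite (@sum_by_card _ (rank K) (fun l => 'X^l * (1 - 'X) ^+ (rank K - l))) //.
apply/polyP => i; rewrite coef_poly coef_sum.
under eq_bigr do rewrite mulr_natl coefMn coefXnM coef_onemX_exp.
rewrite ltnS /hcoef; case: leqP => iK; last first.
  rewrite big1 // => l _; have li : (l < i)%N.
    by apply: leq_ltn_trans iK; rewrite -ltnS.
  by rewrite ltnNge ltnW //= bin_small ?mulr0 ?mul0rn //; lia.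
rewrite (big_ord_widen (rank K).+1 (fun l =>
  (-1) ^+ (i - l) * 'C(rank K - l, i - l)%:R * (fnum K l)%:R)) //.
rewrite big_mkcond; apply: eq_bigr => l _.
by rewrite ltnS leqNgt; case: ltnP => _; rewrite ?mul0rn ?mulr_natr.
Qed.

Lemma link_h_notin d K r : down_closed K -> r \notin K -> link_h d K r = 0.
Proof.
move=> Kdown rK; rewrite /link_h big_seq_cond big_pred0 // => u.
by apply/negP => /andP[uK ru]; case/negP: rK; apply: Kdown uK.
Qed.

(** The existence of a face with d vertices makes d the rank of K. *)
Record gpositive (d i : nat) K : Prop := Gpositive {
  gpos_down : down_closed K;
  gpos_card : forall u, u \in K -> (#|` u| <= d)%N;
  gpos_top : exists2 u, u \in K & #|` u| = d;
  gpos_link : forall r, r \in K -> gcone i (d - #|` r|) (link_h d K r) }.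

End LinkH.

(** * Stellar subdivision *)

Lemma cardfsU_D (V : choiceType) (s r : {fset V}) :
  #|` s `|` r| = (#|` s `\` r| + #|` r|)%N.
Proof.
by rewrite cardfsU cardfsD; have := fsubset_leq_card (fsubsetIl s r); lia.
Qed.

(** K' is the stellar subdivision of K at s with new vertex w: the faces that
contain s are replaced by the w U y, where y does not contain s and s U y is a
face. If K is a complex and s is not a face, then K' is K. *)
Definition is_stellar (V : choiceType) (K : complex V) (s : {fset V}) (w : V)
    (K' : complex V) : Prop :=
  forall x, (x \in K') =
    ((x \in K) && ~~ (s `<=` x)) ||
    [&& w \in x, ~~ (s `<=` x `\ w) & s `|` (x `\ w) \in K].

Section Stellar.
Variables (V : choiceType) (K : complex V) (s : {fset V}) (w : V).
Hypothesis Kdown : down_closed K.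
Hypothesis wK : forall u, u \in K -> w \notin u.
Hypothesis ws : w \notin s.

(** A face y not containing s such that u = s U y is a face is determined by u
and the nonempty set k = s minus y, as y = u minus k; so the new faces are listed
without repetition by pairs (u, k), which turns sums over them into double
sums. *)
Definition stellar_seq : seq {fset V} :=
  [seq u <- K | ~~ (s `<=` u)] ++
  [seq w |` (u `\` k) | u <- [seq u <- K | s `<=` u],
                        k <- [seq k <- fpowerset s | k != fset0]].

Variable K' : complex V.
Hypothesis K'P : is_stellar K s w K'.

Lemma stellar_perm : perm_eq K' stellar_seq.
Proof.
have wD u k : u \in K -> w \notin u `\` k.
  by move/wK; apply: contra; rewrite inE => /andP[].
apply: uniq_perm; first exact: fset_uniq.
  rewrite cat_uniq filter_uniq ?fset_uniq //=; apply/andP; split.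
    apply/hasPn => _ /allpairsP[[u k] /= [_ _ ->]].
    rewrite mem_filter negb_and; apply/orP; right; apply/negP => /wK.
    by rewrite fset1U1.
  apply: allpairs_uniq; rewrite ?filter_uniq ?fset_uniq //.
  move=> _ _ /allpairsP[[u k] /= [+ + ->]] /allpairsP[[u' k'] /= [+ + ->]].
  rewrite !mem_filter !fpowersetE.
  move=> /andP[su uK] /andP[_ ks] /andP[su' uK'] /andP[_ ks'].
  move=> /(congr1 (fun x => x `\ w)); rewrite !fsetU1K ?wD // => E.
  have rec v l : s `<=` v -> l `<=` s ->
      s `|` (v `\` l) = v /\ s `\` (v `\` l) = l.
    rewrite -!fsetD_eq0 => /eqP sv /eqP ls; split.
      by rewrite fsetUDl ls fsetD0; apply/fsetUidPr; rewrite -fsetD_eq0 sv.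
    by rewrite fsetDDr sv fset0U; apply/fsetIidPr; rewrite -fsetD_eq0 ls.
  have [Eu Ek] := rec u k su ks; have [Eu' Ek'] := rec u' k' su' ks'.
  by rewrite -Eu -{2}Ek E Eu' Ek'.
move=> x; rewrite K'P mem_cat mem_filter andbC; congr (_ || _).
apply/and3P/allpairsP => [[wx sx xK]|[[u k] /= [+ +]]].
  exists (s `|` (x `\ w), s `\` (x `\ w)) => /=; split.
  - by rewrite mem_filter fsubsetUl.
  - by rewrite mem_filter fpowersetE fsubsetDl andbT fsetD_eq0.
  - rewrite -[LHS](fsetD1K wx); congr (_ |` _).
    apply/fsetP => y; rewrite !inE.
    by case: (y == w); case: (y \in x); case: (y \in s).
rewrite !mem_filter fpowersetE => /andP[su uK] /andP[/fset0Pn[a ak] ks] ->.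
rewrite fset1U1 fsetU1K ?wD //; split=> //.
  by apply/fsubsetPn; exists a; [apply: (fsubsetP ks)|rewrite !inE ak].
by apply: Kdown uK; rewrite fsubUset su fsubsetDl.
Qed.

Variable d : nat.
Hypothesis Kd : forall u, u \in K -> (#|` u| <= d)%N.

(** The new faces containing r have pairs (u, k) with u containing s U r and k a
nonempty subset of s minus r. These range independently and the weight
factors, so the sum is a product. *)
Lemma sum_new_faces r : ~~ (s `<=` r) ->
  \sum_(u <- K | s `<=` u)
   \sum_(k <- fpowerset s | (k != fset0) && (r `<=` u `\` k))
    'X^(#|` u| - #|` k| - #|` r|) * (1 - 'X) ^+ (d - (#|` u| - #|` k|) - 1)
  = geom (#|` s `\` r| - 1) * link_h d K (s `|` r).
Proof.
move=> sr; have sr0 : s `\` r != fset0 by rewrite fsetD_eq0.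
rewrite mulrC /link_h big_distrl /= (bigID (fun u => r `<=` u)) /=.
rewrite [X in _ + X]big1 => [|u /andP[_ ru]]; last first.
  rewrite big1 // => k /andP[_ rk]; case/negP: ru.
  by apply: fsubset_trans rk _; apply: fsubsetDl.
rewrite addr0 big_seq_cond [RHS]big_seq_cond.
apply: eq_big => u; first by rewrite fsubUset.
move=> /andP[uK /andP[su ru]].
have P : perm_eq [seq k <- fpowerset s | (k != fset0) && (r `<=` u `\` k)]
   [seq k <- fpowerset (s `\` r) | k != fset0].
  apply: uniq_perm; rewrite ?filter_uniq ?fset_uniq // => k.
  rewrite !mem_filter !fpowersetE -andbA; congr (_ && _).
  by rewrite !fsubsetD ru andbC /= fdisjoint_sym.
rewrite -big_filter (perm_big _ P) big_filter.
rewrite -(sum_nonempty_subsets sr0) big_distrr /=.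
rewrite big_seq_cond [RHS]big_seq_cond.
apply: eq_bigr => k /andP[].
rewrite fpowersetE => ks; rewrite -cardfs_gt0 => k0.
have c1 := cardfsU_D s r.
have c2 := fsubset_leq_card ks.
have c3 : (#|` s `|` r| <= #|` u|)%N.
  by apply: fsubset_leq_card; rewrite fsubUset su.
have c4 := Kd uK.
have -> : (#|` u| - #|` k| - #|` r|
  = (#|` u| - #|` s `|` r|) + (#|` s `\` r| - #|` k|))%N by lia.
have -> : (d - (#|` u| - #|` k|) - 1 = (d - #|` u|) + (#|` k| - 1))%N by lia.
by rewrite !exprD; ring.
Qed.

(** With a = #|s minus r|, the second summand is the contribution of the removed
faces and the third that of the new ones; together they are the h-polynomial of
the link of s U r times t + ... + t^(a-1), which is 0 for a = 1. *)
Lemma link_h_stellar_old r : w \notin r -> ~~ (s `<=` r) ->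
  link_h d K' r = link_h d K r - 'X^(#|` s `\` r|) * link_h d K (s `|` r)
    + 'X * (geom (#|` s `\` r| - 1) * link_h d K (s `|` r)).
Proof.
move=> wr sr; rewrite -sum_new_faces // [LHS](perm_big _ stellar_perm) big_cat.
rewrite big_filter_cond /=; congr (_ + _).
  apply: (canRL (addrK _)).
  rewrite addrC [RHS](bigID (fun u => s `<=` u)) /=; congr (_ + _); last first.
    by apply: eq_bigl => u; rewrite andbC.
  rewrite /link_h big_distrr /=; apply: eq_big => u.
    by rewrite fsubUset andbC.
  rewrite fsubUset => /andP[su ru]; rewrite mulrA -exprD; congr ('X^_ * _).
  have c1 := cardfsU_D s r.
  have c3 : (#|` s `|` r| <= #|` u|)%N.
    by apply: fsubset_leq_card; rewrite fsubUset su.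
  by lia.
rewrite big_mkcond big_allpairs_dep big_filter big_distrr /=.
rewrite big_seq_cond [RHS]big_seq_cond; apply: eq_bigr => u /andP[uK su].
rewrite -big_mkcond /= big_filter_cond big_distrr /=.
rewrite big_seq_cond [RHS]big_seq_cond.
have wu := wK uK.
have wD k : w \notin u `\` k by apply: contra wu; rewrite inE => /andP[].
have E k : (r `<=` w |` (u `\` k)) = (r `<=` u `\` k).
  by rewrite -fsubDset; congr (_ `<=` _); apply/fsetDidPl; rewrite fdisjointX1.
apply: eq_big => k; first by rewrite E.
rewrite E fpowersetE => /and3P[ks _ ruk].
have ku : #|` u `\` k| = (#|` u| - #|` k|)%N.
  by rewrite cardfsDS // (fsubset_trans ks).
rewrite cardfsU1 wD ku mulrA -exprS; congr ('X^_ * (_ ^+ _)); last by lia.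
by have := fsubset_leq_card ruk; rewrite ku; lia.
Qed.

(** The link of w U r is the join of the boundary of the simplex on s minus r with
the link of s U r, and h is multiplicative on joins. *)
Lemma link_h_stellar_new r : w \notin r -> ~~ (s `<=` r) ->
  link_h d K' (w |` r) = geom (#|` s `\` r| - 1) * link_h d K (s `|` r).
Proof.
move=> wr sr; rewrite -sum_new_faces // [LHS](perm_big _ stellar_perm) big_cat.
rewrite big_filter_cond /= big_seq_cond big_pred0 => [|u]; last first.
  apply/negP => /and3P[/wK wu _]; rewrite fsubUset fsub1set => /andP[].
  by rewrite (negPf wu).
rewrite add0r big_mkcond big_allpairs_dep big_filter /=.
rewrite big_seq_cond [RHS]big_seq_cond; apply: eq_bigr => u /andP[uK su].
rewrite -big_mkcond /= big_filter_cond /= big_seq_cond [RHS]big_seq_cond.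
have wu := wK uK.
have wD k : w \notin u `\` k by apply: contra wu; rewrite inE => /andP[].
have E k : (w |` r `<=` w |` (u `\` k)) = (r `<=` u `\` k).
  rewrite fsubUset fsub1set fset1U1 /= -fsubDset; congr (_ `<=` _).
  by apply/fsetDidPl; rewrite fdisjointX1.
apply: eq_big => k; first by rewrite E.
rewrite E fpowersetE => /and3P[ks _ ruk].
have ku : #|` u `\` k| = (#|` u| - #|` k|)%N.
  by rewrite cardfsDS // (fsubset_trans ks).
rewrite !cardfsU1 wD wr ku; congr ('X^_ * (_ ^+ _)); last by lia.
Qed.

End Stellar.

Section Step.
Variables (V : choiceType) (d i : nat) (i0 : (0 < i)%N).
Implicit Types (K : complex V).

(** Every link of K' has an h-polynomial built from those of links of K by adding
and by multiplying by t geom(a-2), which raises the rank by a, or by geom(a-1).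
As a <= #|s| <= i + 1, the cones are closed under both. *)
Lemma gpositive_stellar K K' (s : {fset V}) (w : V) :
  w \notin s -> (forall u, u \in K -> w \notin u) ->
  s != fset0 -> (#|` s| <= i.+1)%N -> is_stellar K s w K' ->
  gpositive d i K -> gpositive d i K'.
Proof.
move=> ws wK s0 si K'P gK; have [Kdown Kd [t tK td] _] := gK.
split.
- move=> r u ru; rewrite !K'P => /orP[/andP[uK su]|/and3P[wu su uK]].
    by rewrite (Kdown _ _ ru) //= (contra _ su) // => /fsubset_trans; apply.
  have ruw : r `\ w `<=` u `\ w by apply: fsetSD.
  have srw : ~~ (s `<=` r `\ w) by apply: contra su => /fsubset_trans; apply.
  have rK : s `|` (r `\ w) \in K by apply: Kdown uK; apply: fsetUS.
  case: (boolP (w \in r)) => wr; first by rewrite srw rK orbT.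
  have Er : r `\ w = r by apply/fsetDidPl; rewrite fdisjointX1.
  rewrite Er in srw rK; rewrite srw (_ : r \in K) //.
  by rewrite (Kdown _ _ _ rK) ?fsubsetUr.
- move=> u; rewrite K'P => /orP[/andP[/Kd]//|/and3P[wu su /Kd]].
  have := fproper_ltn_card (_ : u `\ w `<` s `|` (u `\ w)).
  rewrite (cardfsD1 w u) wu add1n => /(_ _) H1 H2; apply: leq_trans H2.
  by apply: H1; rewrite fproperE fsubsetUr fsubUset (negPf su).
- (* A largest face t that contains s is replaced by faces of the same size. *)
  case: (boolP (s `<=` t)) => st; last by exists t => //; rewrite K'P tK st.
  have [a aS] := fset0Pn _ s0.
  have wta : w \notin t `\ a by apply: contra (wK _ tK); rewrite inE => /andP[].
  exists (w |` (t `\ a)).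
    rewrite K'P fset1U1 fsetU1K //; apply/orP; right.
    rewrite (Kdown _ _ _ tK) ?andbT /=; last by rewrite fsubUset st fsubsetDl.
    by apply/fsubsetPn; exists a; rewrite // !inE eqxx.
  by rewrite cardfsU1 wta -td (cardfsD1 a t) (fsubsetP st _ aS).
have cD r : (#|` s `\` r| <= i.+1)%N.
  by apply: leq_trans si; apply/fsubset_leq_card/fsubsetDl.
have cD0 r : ~~ (s `<=` r) -> (0 < #|` s `\` r|)%N.
  by rewrite cardfs_gt0 fsetD_eq0.
move=> r rK'; have := rK'; rewrite K'P => /orP[/andP[rK sr]|/and3P[wr sr rK]].
  rewrite (link_h_stellar_old Kdown wK ws K'P Kd (wK _ rK) sr).
  case: (boolP (s `|` r \in K)) => srK; last first.
    by rewrite (link_h_notin _ Kdown srK) !mulr0 subr0 addr0; apply: gpos_link.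
  have := cD0 _ sr; have := cD r; have := gpos_link gK srK.
  have := Kd _ srK; rewrite cardfsU_D.
  move: #|` s `\` r| => [|[|a]] // cd H ai _.
    (* Starring at a vertex leaves the h-polynomial of the link unchanged. *)
    by rewrite subnn geom0 mul1r expr1 addrNK; apply: gpos_link.
  have -> : link_h d K r - 'X^(a.+2) * link_h d K (s `|` r) +
     'X * (geom (a.+2 - 1) * link_h d K (s `|` r)) =
     link_h d K r + 'X * (link_h d K (s `|` r) * geom a).
    by rewrite subn1 geomS [in 'X^(a.+2)]exprS; ring.
  apply: gconeD; first exact: gpos_link.
  have -> : (d - #|` r| = (d - (a.+2 + #|` r|) + a).+2)%N by lia.
  by apply: gcone_mulX; apply: gcone_mul_geom => //; lia.
have wr' : w \notin r `\ w by rewrite !inE eqxx.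
rewrite -(fsetD1K wr) (link_h_stellar_new Kdown wK ws K'P Kd wr' sr).
rewrite mulrC; have H := gpos_link gK rK.
rewrite cardfsU1 wr' /=.
have := Kd _ rK; move: H (cD0 _ sr) (cD (r `\ w)).
rewrite cardfsU_D => H c0 ci cd.
have -> : (d - (1 + #|` r `\ w|) =
  d - (#|` s `\` (r `\ w)| + #|` r `\ w|) + (#|` s `\` (r `\ w)| - 1))%N.
  by lia.
by apply: gcone_mul_geom => //; lia.
Qed.

End Step.

(** * The cross-polytope *)

Section CrossPolytope.
Variables (V : choiceType) (d : nat) (e : 'I_d * bool -> V).
Hypothesis e_inj : injective e.
Local Notation K := (cross_polytope e).
Implicit Types f g : {ffun 'I_d -> option bool}.

(** A face of the cross-polytope picks at most one of the two antipodal vertices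
in each coordinate; coding this choice by [f k : option bool] makes sums over
faces distribute over products. *)
Definition sign_face f : {fset V} :=
  [fset e x | x in [pred x : 'I_d * bool | f x.1 == Some x.2]].

Lemma mem_sign_face f x : (e x \in sign_face f) = (f x.1 == Some x.2).
Proof. by rewrite mem_imfset. Qed.

Lemma sign_face_sub g f : (sign_face g `<=` sign_face f) =
  (f \in family (fun k => [pred o | (g k == None) || (o == g k)])).
Proof.
apply/fsubsetP/familyP => [H k|H _ /imfsetP[[k b] /= gk ->]].
  rewrite inE; case gk: (g k) => [b|] //=.
  by have := H (e (k, b)); rewrite !mem_sign_face /= gk eqxx; apply.
by rewrite mem_sign_face; have := H k; rewrite !inE /= (eqP gk).
Qed.

Lemma sign_face_inj : injective sign_face.
Proof.
move=> f g E; apply/ffunP => k.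
have H b : (f k == Some b) = (g k == Some b).
  by have := mem_sign_face f (k, b); rewrite E mem_sign_face.
by have := (H true, H false); case: (f k) => [[]|]; case: (g k) => [[]|] // [].
Qed.

Lemma cross_polytope_perm :
  perm_eq K [seq sign_face f | f <- index_enum {ffun 'I_d -> option bool}].
Proof.
apply: uniq_perm; first exact: fset_uniq.
  by rewrite (map_inj_uniq sign_face_inj) index_enum_uniq.
move=> s; rewrite !inE fpowersetE.
apply/andP/mapP => [[sE /forallP sK]|[f _ ->]].
  exists [ffun k => if e (k, true) \in s then Some true else
                    if e (k, false) \in s then Some false else None].
    by rewrite mem_index_enum.
  apply/fsetP => y; case: (boolP (y \in [fset e x | x : 'I_d * bool])) => [|yE].
    case/imfsetP => -[k b] _ ->; rewrite mem_sign_face ffunE /=.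
    by have := sK k; case: b; case: (e (k, true) \in s);
      case: (e (k, false) \in s).
  have /negPf-> : y \notin s by apply: contra yE; apply: (fsubsetP sE).
  by apply/esym/negbTE; apply: contra yE => /imfsetP[x _ ->]; apply: in_imfset.
split; first by apply/fsubsetP => _ /imfsetP[x _ ->]; apply: in_imfset.
by apply/forallP => k; rewrite !mem_sign_face /=; case: (f k) => [[]|].
Qed.

Lemma sign_faceP u : reflect (exists f, u = sign_face f) (u \in K).
Proof.
rewrite (perm_mem cross_polytope_perm).
by apply: (iffP mapP) => [[f _ ->]|[f ->]]; exists f; rewrite ?mem_index_enum.
Qed.

Lemma card_sign_face f : #|` sign_face f| = (\sum_k (f k != None))%N.
Proof.
rewrite card_imfset //= -cardE -sum1_card big_mkcond /=.
rewrite -(pair_bigA _ (fun k b => if f k == Some b then 1 else 0)%N) /=.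
by apply: eq_bigr => k _; rewrite big_bool; case: (f k) => [[]|].
Qed.

Lemma card_sign_face_le f : (#|` sign_face f| <= d)%N.
Proof.
rewrite card_sign_face -[leqRHS](card_ord d) -sum1_card.
by apply: leq_sum => k _; apply: leq_b1.
Qed.

Lemma sign_face_weight f (a b : {poly int}) :
  \prod_k (if f k == None then b else a) =
    a ^+ #|` sign_face f| * b ^+ (d - #|` sign_face f|).
Proof.
have -> : (d - #|` sign_face f| = \sum_k (f k == None))%N.
  apply: (@addIn #|` sign_face f|); rewrite subnK ?card_sign_face_le //.
  rewrite card_sign_face -big_split /= -[LHS](card_ord d) -sum1_card.
  by apply: eq_bigr => k _; case: eqP.
rewrite card_sign_face -!prodrXr -big_split; apply: eq_bigr => k _ /=.
by case: eqP => _; rewrite ?mul1r ?mulr1.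
Qed.

(** After multiplication by t^#|g| the sum over the faces containing g is a
product over coordinates, with factor (1 - t) + t + t = 1 + t where g makes no
choice and t elsewhere. *)
Lemma link_h_cross_polytope g :
  link_h d K (sign_face g) = (1 + 'X) ^+ (d - #|` sign_face g|).
Proof.
have X0 : 'X^(#|` sign_face g|) != 0 :> {poly int}.
  by rewrite expf_neq0 // polyX_eq0.
apply: (mulfI X0); rewrite -sign_face_weight.
transitivity (\prod_(k < d) \sum_(o | (g k == None) || (o == g k))
   (if o == None then 1 - 'X else 'X) : {poly int}); last first.
  apply: eq_bigr => k _; case gk: (g k) => [b|] /=.
    by rewrite big_pred1_eq.
  rewrite (bigD1 None) //= (bigD1 (Some true)) //= (bigD1 (Some false)) //=.
  rewrite big1 => [|[[]|]] //; ring.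
rewrite bigA_distr_big_dep /link_h big_distrr /=.
rewrite (perm_big _ cross_polytope_perm).
rewrite big_map; apply: eq_big => f; first exact: sign_face_sub.
move=> gf; rewrite sign_face_weight mulrA -exprD subnKC //.
exact: fsubset_leq_card.
Qed.

Lemma gpositive_cross_polytope i : (0 < i)%N -> gpositive d i K.
Proof.
move=> i0; split.
- move=> r u ru; rewrite !inE !fpowersetE => /andP[uE /forallP uK].
  rewrite (fsubset_trans ru) //; apply/forallP => k; apply: contra (uK k).
  by case/andP => /(fsubsetP ru)-> /(fsubsetP ru)->.
- by move=> _ /sign_faceP[f ->]; apply: card_sign_face_le.
- exists (sign_face [ffun=> Some true]); first by apply/sign_faceP; eexists.
  rewrite card_sign_face -[RHS](card_ord d) -sum1_card.
  by apply: eq_bigr => k _; rewrite ffunE.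
- move=> _ /sign_faceP[f ->]; rewrite link_h_cross_polytope.
  exact: gcone_1X.
Qed.

End CrossPolytope.

(** * The replacement of a face by a starred simplex *)

Section ReplaceFace.
Variables (W V : choiceType) (B : {fset W}) (v : W).
Hypotheses (B2 : (1 < #|` B|)%N) (vB : v \notin B).

Lemma starringP x :
  reflect (exists2 b, b `<` B & x = b \/ x = v |` b) (x \in starring B v).
Proof.
have bdP b : (b \in simplex_boundary B) = (b `<` B).
  by rewrite !inE fpowersetE fproperEneq.
rewrite in_fsetU bdP; apply: (iffP orP) => [[xB|/imfsetP[b /=]]|].
- by exists x => //; left.
- by rewrite bdP => bB ->; exists b => //; right.
- by move=> [b bB [->|->]]; [left|right; apply: in_imfset; rewrite /= bdP].
Qed.

Lemma verts_starring y : y \in v |` B -> y \in verts (starring B v).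
Proof.
move=> yE.
have [b bS yb] : exists2 b, b \in starring B v & y \in b; last first.
  by apply/bigfcupP; exists b; rewrite ?bS.
have B0 : fset0 `<` B by rewrite fproperEcard fsub0set cardfs0 ltnW.
case/fset1UP: yE => [->|yB].
  by exists (v |` fset0); [apply/starringP; exists fset0; auto|rewrite fset1U1].
exists [fset y]; last by rewrite inE.
apply/starringP; exists [fset y]; last by left.
by rewrite fproperEcard fsub1set yB cardfs1.
Qed.

Variables (K : complex V) (s : {fset V}) (psi : W -> V).
Hypothesis Kdown : down_closed K.
Hypothesis psiP : gluing_map (starring B v) B K s psi.

Let psi_inj : {in v |` B &, injective psi}.
Proof.
by case: psiP => I _ _ x y /verts_starring xv /verts_starring; apply: I.
Qed.

Lemma gluing_apex_notin_face : psi v \notin s.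
Proof.
case: psiP => _ <- _; apply: contra vB => /imfsetP[b /= bB].
by move/psi_inj ->; rewrite ?fset1U1 // fset1Ur.
Qed.

Lemma gluing_apex_new u : u \in K -> psi v \notin u.
Proof.
case: psiP => _ _ /(_ v) H uK; apply: contra (H _ vB) => [vu|].
  by apply/bigfcupP; exists u; rewrite ?uK.
by apply: verts_starring; rewrite fset1U1.
Qed.

(** With the starred simplex glued in, the faces of the boundary of s only give
back faces of K, and the cones over them give the faces of the stellar
subdivision that contain the new vertex. *)
Lemma is_stellar_replace_face :
  is_stellar K s (psi v) (replace_face (starring B v) psi s K).
Proof.
have [_ psiB _] := psiP; set w := psi v.
have sD y : [disjoint s & y `\` s].
  by apply/fdisjointP => z zs; rewrite inE zs.
have linkP t : reflect [/\ [disjoint s & t] & s `|` t \in K] (t \in link K s).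
  rewrite !inE -fsetI_eq0; apply: (iffP and3P) => [[]//|[st stK]]; split=> //.
  by apply: Kdown stK; apply: fsubsetUr.
have oldE x : x \in K -> (x \in [fset s `|` t | t in link K s]) = (s `<=` x).
  move=> xK; apply/imfsetP/idP => [[t _ ->]|sx]; first exact: fsubsetUl.
  exists (x `\` s); last by rewrite fsetUDl fsetDv fsetD0 (fsetUidPr _ _ sx).
  by apply/linkP; rewrite fsetUDl fsetDv fsetD0 (fsetUidPr _ _ sx) sD.
have imP b t : b `<` B -> t \in link K s ->
    [/\ ~~ (s `<=` psi @` b `|` t), s `|` (psi @` b `|` t) \in K
      & w \notin psi @` b `|` t].
  move=> bB /linkP[st stK].
  have bs : psi @` b `<=` s.
    apply/fsubsetP => _ /imfsetP[y /= yb ->]; rewrite -psiB.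
    by apply: in_imfset; apply: (fsubsetP (fproper_sub bB)).
  have stK' : s `|` (psi @` b `|` t) \in K by rewrite fsetUA (fsetUidPl _ _ bs).
  split=> //; last first.
    apply: contra (gluing_apex_new stK').
    by apply: (fsubsetP (fsubsetUr s _)).
  have /fsubsetPn[y yB yb] : ~~ (B `<=` b) by case/andP: bB.
  have ys : psi y \in s by rewrite -psiB; apply: in_imfset.
  apply/fsubsetPn; exists (psi y) => //; rewrite in_fsetU negb_or.
  rewrite (fdisjointP st) // andbT; apply: contra yb => /imfsetP[z /= zb].
  move/psi_inj ->; rewrite ?fset1Ur //.
  by apply: (fsubsetP (fproper_sub bB)).
move=> x; rewrite in_fsetU in_fsetD; apply/orP/orP => [[/andP[xo xK]|]|].
- by left; rewrite -oldE // xK.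
- case/imfset2P => s' /= /starringP[b bB E] [t tL ->].
  have [n1 n2 n3] := imP _ _ bB tL; case: E => ->.
    by left; rewrite n1 andbT; apply: Kdown n2; apply: fsubsetUr.
  right; rewrite imfsetU imfset_fset1 -fsetUA fset1U1 fsetU1K //.
  by rewrite n1 n2.
- move=> [/andP[xK sx]|/and3P[wx sx xK]]; first by left; rewrite oldE // sx.
(* The part of x inside s is the image of b; the rest lies in the link of s. *)
right; pose y := x `\ w; pose b := [fset z in B | psi z \in y].
have Eb : psi @` b = s `&` y.
  apply/fsetP => z; rewrite in_fsetI; apply/imfsetP/andP => [[c /=]|[]].
    by rewrite !inE /= => /andP[cB cy] ->; split; rewrite // -psiB in_imfset.
  rewrite -psiB => /imfsetP[c /= cB ->] cy; exists c => //.
  by move: cy; rewrite !inE /= cB.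
have -> : x = psi @` (v |` b) `|` (y `\` s).
  rewrite imfsetU imfset_fset1 Eb -fsetUA -[LHS](fsetD1K wx); congr (_ |` _).
  by rewrite fsetIC fsetID.
apply: in_imfset2 => /=; last by apply/linkP; rewrite fsetUDl fsetDv fsetD0.
apply/starringP; exists b; last by right.
rewrite fproperEneq; apply/andP; split; last first.
  by apply/fsubsetP => z; rewrite !inE => /andP[].
apply: contra sx => /eqP bE; rewrite bE psiB in Eb.
by rewrite Eb fsubsetIr.
Qed.

End ReplaceFace.

(** * Nonnegativity of the g-vector *)

Lemma rank_eq (V : choiceType) (K : complex V) d :
  (forall u, u \in K -> (#|` u| <= d)%N) -> (exists2 u, u \in K & #|` u| = d) ->
  rank K = d.
Proof.
move=> Kd [u uK ud]; rewrite -ud; apply/eqP; rewrite eqn_leq.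
apply/andP; split; last exact: leq_bigmax_seq.
by apply/bigmax_leqP_seq => t tK _; rewrite ud Kd.
Qed.

Theorem corollary9p4 (i j d : nat) (hj : (1 <= j)%N) (hji : (j <= i)%N)
    (hd : (1 <= d)%N)
    (W : choiceType) (B : {fset W}) (v : W)
    (hB : #|` B| = j.+1) (hv : v \notin B)
    (V : choiceType) (e : 'I_d * bool -> V) (he : injective e)
    (K : complex V)
    (hK : gen_tchebyshev (starring B v) B (cross_polytope e) K) :
  exists g : 'rV[int]_((rank K)./2).+1,
    is_gvector i K g /\ forall k, 0 <= g 0 k.
Proof.
have i0 : (0 < i)%N := leq_trans hj hji.
case: hK => sigma [psi [Ks [_ sigmaE K0 <- step]]].
have gK l : (l <= size sigma)%N -> gpositive d i (Ks l).
  elim: l => [|l IH] lm; first by rewrite K0; apply: gpositive_cross_polytope.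
  have gKl := IH (ltnW lm); have [psiP ->] := step l lm.
  have : nth fset0 sigma l \in faces (cross_polytope e) #|` B|.
    by rewrite -sigmaE mem_nth.
  rewrite !inE /= => /andP[_ /eqP cs].
  have B2 : (1 < #|` B|)%N by rewrite hB.
  have Kdown := gpos_down gKl.
  apply: gpositive_stellar gKl => //.
  - exact: (gluing_apex_notin_face B2 hv psiP).
  - exact: (gluing_apex_new B2 hv psiP).
  - by rewrite -cardfs_gt0 cs hB.
  - by rewrite cs hB.
  - exact: is_stellar_replace_face.
have gL := gK _ (leqnn _); have [Kdown Kd Ktop _] := gL.
have rk := rank_eq Kd Ktop; have [t tK _] := Ktop.
have h0 : fset0 \in Ks (size sigma) by apply: Kdown tK; apply: fsub0set.
have := gpos_link gL h0; rewrite cardfs0 subn0 -rk -hpoly_link_h.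
by move=> /gcone_coords[c c0 E]; exists c.
Qed.
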